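(* Let $\mathcal S_C$ be the collection of all complete sets of continuous roots of the family of monic quadratic polynomials $z^2+a_1z+a_0$ with real coefficients. Then $$\mathcal S_C = \big\{\{\Xi(\varnothing), \Xi(\mathbb R^2_\pm)\},\ \{\Xi(\mathbb R^2_+), \Xi(\mathbb R^2_-)\}\big\}.$$
   Context: For $M=(a_0,a_1)\in\mathbb R^2$ and $z\in\mathbb C$ put $F^2(M,z) := z^2 + a_1 z + a_0$, and let $D(a_0,a_1) := a_1^2 - 4a_0$ be the discriminant. A root of the family of real monic quadratics is a function $r:\mathbb R^2\to\mathbb C$ (not assumed continuous) such that $F^2(M,r(M))=0$ for every $M\in\mathbb R^2$. Let $\mathfrak R$ be the set of all such roots, and let $\mathfrak R_C$ be the set of those $r\in\mathfrak R$ that are continuous on $\mathbb R^2$. An (unordered) pair $\{\alpha,\beta\}\subseteq\mathfrak R$ is called a complete set of roots of the family if $F^2(M,z) = (z-\alpha(M))(z-\beta(M))$ for all $(M,z)\in\mathbb R^2\times\mathbb C$. If moreover $\{\alpha,\beta\}\subseteq\mathfrak R_C$, it is called a complete set of continuous roots. Let $\mathbb R^2_0 := \{(x,y)\in\mathbb R^2 : 4x = y^2\}$, $\mathbb R^2_+ := \{(x,y)\in\mathbb R^2 : 4x < y^2\}$, $\mathbb R^2_- := \{(x,y)\in\mathbb R^2 : 4x > y^2\}$, $\mathbb R^2_\pm := \mathbb R^2\setminus\mathbb R^2_0$. For $X\subseteq\mathbb R^2_\pm$ and $M\in\mathbb R^2$ define $S(X,M) := -1$ if $M\in X$, $S(X,M):=0$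 if $M\in\mathbb R^2_0$, and $S(X,M):=+1$ if $M\in\mathbb R^2_\pm\setminus X$. For $X\subseteq\mathbb R^2_\pm$ let $\Xi(X):\mathbb R^2\to\mathbb C$ be the function $$\Xi(X)(a_0,a_1) := \begin{cases} -\dfrac{a_1}{2} + S(X,(a_0,a_1))\,\dfrac{\sqrt{D(a_0,a_1)}}{2}, & (a_0,a_1)\in\mathbb R^2_+,\\[1ex] -\dfrac{a_1}{2}, & (a_0,a_1)\in\mathbb R^2_0,\\[1ex] -\dfrac{a_1}{2} + S(X,(a_0,a_1))\,\dfrac{\sqrt{-D(a_0,a_1)}}{2}\, i, & (a_0,a_1)\in\mathbb R^2_-,\end{cases}$$ where $i$ is the imaginary unit and the square roots are the nonnegative real ones. *)

(* Defs.v *)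
From HB Require Import structures.
From mathcomp Require Import all_boot all_order all_algebra.
From mathcomp Require Import all_classical all_reals all_analysis.
From mathcomp Require Import complex.

Set Implicit Arguments.
Unset Strict Implicit.
Unset Printing Implicit Defensive.

Import Order.TTheory GRing.Theory Num.Theory.
Import numFieldNormedType.Exports.

Local Open Scope classical_set_scope.
Local Open Scope ring_scope.
Local Open Scope complex_scope.

Section MonicQuadratics.
Variable R : realType.

(* A point M = (a_0, a_1) of the plane is a pair, with a_0 = M.1, a_1 = M.2. *)
Implicit Types (M : R * R) (z : R[i]) (X : set (R * R)).

Definition F2 M z : R[i] := z ^+ 2 + M.2%:C * z + M.1%:C.

Definition discr M : R := M.2 ^+ 2 - 4 * M.1.

Definition family_roots : set (R * R -> R[i]) :=
  [set r | forall M, F2 M (r M) = 0].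

(* (R[i])^o carries the topology of the complex modulus, and R * R the product
   topology. *)
Definition continuous_family_roots : set (R * R -> R[i]) :=
  [set r | family_roots r /\ continuous (r : R * R -> (R[i])^o)].

(* An unordered pair {alpha, beta} is the set [set alpha; beta]. *)
Definition complete_set_of_roots (A : set (R * R -> R[i])) : Prop :=
  exists alpha beta : R * R -> R[i],
    [/\ A = [set alpha; beta],
        A `<=` family_roots &
        forall M z, F2 M z = (z - alpha M) * (z - beta M)].

Definition complete_set_of_continuous_roots (A : set (R * R -> R[i])) : Prop :=
  complete_set_of_roots A /\ A `<=` continuous_family_roots.

Definition plane_zero : set (R * R) := [set M | 4 * M.1 = M.2 ^+ 2].
Definition plane_plus : set (R * R) := [set M | 4 * M.1 < M.2 ^+ 2].
Definition plane_minus : set (R * R) := [set M | 4 * M.1 > M.2 ^+ 2].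
Definition plane_pm : set (R * R) := ~` plane_zero.

(* Only meaningful for X `<=` plane_pm, in which case the first two tests
   exclude each other; likewise for Xi. *)
Definition branch_sign X M : R :=
  if M \in X then -1 else if M \in plane_zero then 0 else 1.

(* The last branch is the case of plane_minus. *)
Definition Xi X : R * R -> R[i] := fun M =>
  if M \in plane_plus then
    (- (M.2 / 2))%:C + (branch_sign X M * (Num.sqrt (discr M) / 2))%:C
  else if M \in plane_zero then
    (- (M.2 / 2))%:C
  else
    (- (M.2 / 2))%:C + (branch_sign X M * (Num.sqrt (- discr M) / 2))%:C * 'i.

End MonicQuadratics.

Arguments plane_zero {R}.
Arguments plane_plus {R}.
Arguments plane_minus {R}.
Arguments plane_pm {R}.

(* Main.v *)
(* If r is a continuous root, r + a_1/2 squares to discr / 4, so it is real and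
   nonzero where discr > 0, and purely imaginary and nonzero where discr < 0.
   Both regions are connected, so one sign on each determines r.  Conversely
   all four choices of signs are continuous, because Num.sqrt vanishes on
   negative reals and hence
     - a_1/2 +- Num.sqrt(discr)/2 +- i Num.sqrt(- discr)/2
   is valid on the whole plane.  The second root of a pair is - a_1 minus the
   first one, which flips both signs. *)
Require Import Defs.
From mathcomp Require Import all_boot all_order all_algebra.
From mathcomp Require Import all_classical all_reals all_analysis.
From mathcomp Require Import complex.
From mathcomp Require Import ring lra.

Set Implicit Arguments.
Unset Strict Implicit.
Unset Printing Implicit Defensive.

Import Order.TTheory GRing.Theory Num.Theory.
Import numFieldNormedType.Exports.

Local Open Scope classical_set_scope.
Local Open Scope ring_scope.
Local Open Scope complex_scope.

(** * Continuity into and out of the complex plane, by coordinates *)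

Section ComplexContinuity.
Variables (R : realType) (T : topologicalType).
Implicit Types f g : T -> R.

Lemma normc_ge_Im (z : R[i]) : `|complex.Im z|%:C <= `|z|.
Proof.
by case: z => x y; rewrite normc_def lecR -sqrtr_sqr ler_wsqrtr //= lerDr sqr_ge0.
Qed.

(** The real part is 1-Lipschitz for the modulus, so the radius [e] itself serves. *)
Lemma continuous_Re : continuous (@complex.Re R : (R[i])^o -> R).
Proof.
move=> z; apply/(@cvgrPdist_lt _ _ _ _ (@nbhs_filter (R[i])^o z)) => e e0.
have e0' : 0 < e%:C by rewrite ltcR.
apply: (@filterS _ (nbhs (z : (R[i])^o)) _ _ _ _ (nbhsx_ballx _ _ e0')) => w zw; rewrite -ltcR; apply: le_lt_trans zw.
by move: (normc_ge_Re (z - w)); case: (z); case: (w).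
Qed.

Lemma continuous_Im : continuous (@complex.Im R : (R[i])^o -> R).
Proof.
move=> z; apply/(@cvgrPdist_lt _ _ _ _ (@nbhs_filter (R[i])^o z)) => e e0.
have e0' : 0 < e%:C by rewrite ltcR.
apply: (@filterS _ (nbhs (z : (R[i])^o)) _ _ _ _ (nbhsx_ballx _ _ e0')) => w zw; rewrite -ltcR; apply: le_lt_trans zw.
by move: (normc_ge_Im (z - w)); case: (z); case: (w).
Qed.

Lemma continuous_real_complex f :
  continuous f -> continuous (fun t => (f t)%:C : (R[i])^o).
Proof.
move=> cf t; apply/cvgrPdist_lt => -[e e'].
(* The radius is an element of [R[i]]; its positivity forces a zero imaginary part. *)
rewrite ltcE /= => /andP[/eqP -> e0].
have /cvgrPdist_lt /(_ _ e0) := cf t.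
apply: filterS => s ts; rewrite -rmorphB normc_def /= expr0n addr0 sqrtr_sqr.
by rewrite ltcR.
Qed.

Lemma continuous_Complex f g : continuous f -> continuous g ->
  continuous (fun t => f t +i* g t : (R[i])^o).
Proof.
move=> cf cg t.
have -> : (fun t => f t +i* g t : (R[i])^o) =
    (fun t => ((f t)%:C : (R[i])^o) + 'i *: ((g t)%:C : (R[i])^o)).
  by apply/funext => s; rewrite [LHS]complexE.
apply: cvgD; first exact: continuous_real_complex.
by apply: cvgZl_tmp; exact: continuous_real_complex.
Qed.

End ComplexContinuity.

(** * Continuous roots and their sign branches *)

Section QuadraticRoots.
Variable R : realType.
Implicit Types (M : R * R) (b c : bool).

Lemma continuous_discr : continuous (@discr R).
Proof.
move=> M; apply: cvgB; last by apply: cvgMl_tmp; exact: cvg_fst.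
by apply: cvgM; exact: cvg_snd.
Qed.

(* One of the regions [discr > 0] ([k = 1]) and [discr < 0] ([k = -1]).  In the
   coordinates (discr, a_1) it is a half-plane, so a segment in these
   coordinates and the intermediate value theorem give the constant sign. *)
Lemma nonvanishing_constant_sign (k : R) (g : R * R -> R) : continuous g ->
  (forall M, 0 < k * discr M -> g M != 0) ->
  exists b, forall M, 0 < k * discr M -> 0 < (-1) ^+ b * g M.
Proof.
move=> cg g0.
have [pos|] := pselect (forall M, 0 < k * discr M -> 0 < g M).
  by exists false => M /pos; rewrite mul1r.
move=> /existsNP[N /not_implyP[kN /negP]]; rewrite -leNgt => gN.
exists true => M kM; rewrite mulN1r oppr_gt0 ltNge; apply/negP => gM.
pose d t := discr N + t * (discr M - discr N).
pose y t := N.2 + t * (M.2 - N.2).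
(* Back to the original coordinates: a_0 solves a_1^2 - 4 a_0 = [d t] with a_1 = [y t]. *)
pose p t : R * R := ((y t ^+ 2 - d t) / 4, y t).
have cl (u v : R) : continuous (fun t : R => u + t * v).
  by move=> t; apply: cvgD; [exact: cvg_cst|apply: cvgMr_tmp; exact: cvg_id].
have cp : continuous p.
  move=> t; apply: (@cvg_pair _ _ _ (nbhs t) (nbhs (p t).1) (nbhs (p t).2)); last exact: cl.
  apply: cvgMr_tmp; apply: cvgB; last exact: cl.
  by apply: cvgM; exact: cl.
have [||t] := @IVT R (g \o p) 0 1 0 ler01.
- by apply: continuous_subspaceT => t; apply: continuous_comp; [exact: cp|exact: cg].
- have -> : (g \o p) 0 = g N.
    rewrite /p /y /d /discr /=; case: N {kN gN d y p cp} => u v /=.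
    by congr (g (_, _)); field.
  have -> : (g \o p) 1 = g M.
    rewrite /p /y /d /discr /=; case: M N {kM gM kN gN d y p cp} => u v [u' v'] /=.
    by congr (g (_, _)); field.
  by rewrite ge_min gN le_max gM orbT.
- rewrite in_itv /= => /andP[t0 t1] /eqP; apply/negP/g0.
  have -> : discr (p t) = d t by rewrite /discr /p /=; field.
  have -> : k * d t = (1 - t) * (k * discr N) + t * (k * discr M).
    by rewrite /d; ring.
  (* For [t > 0] the second summand is positive and the first nonnegative; at [t = 0] only
     [k * discr N] remains. *)
  have [t0'|] := ltrP 0 t.
    by apply: ltr_wpDl; [apply: mulr_ge0; rewrite ?subr_ge0 ?(ltW kN)|exact: mulr_gt0].
  by move=> t0'; rewrite (le_anti (introT andP (conj t0' t0))) subr0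
    mul1r mul0r addr0.
Qed.

(** [b] carries the sign where discr > 0 and [c] the sign where discr < 0, with [true] for minus. *)
Definition root_branch b c : R * R -> R[i] := fun M =>
  (- (M.2 / 2) + (-1) ^+ b * (Num.sqrt (discr M) / 2))
  +i* ((-1) ^+ c * (Num.sqrt (- discr M) / 2)).

Lemma continuous_root_branch b c :
  continuous (root_branch b c : R * R -> (R[i])^o).
Proof.
apply: continuous_Complex => M.
  apply: cvgD; first by apply: cvgN; apply: cvgMr_tmp; exact: cvg_snd.
  apply: cvgMl_tmp; apply: cvgMr_tmp.
  by apply: continuous_comp; [exact: continuous_discr|exact: sqrt_continuous].
apply: cvgMl_tmp; apply: cvgMr_tmp; apply: continuous_comp; last exact: sqrt_continuous.
by apply: cvgN; exact: continuous_discr.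
Qed.

(** Let P and Q be the signed square roots of D and -D. Then P^2 - Q^2 = D and PQ = 0, so (P + iQ)^2
    = D, and the product is (z + a_1/2)^2 - D/4. *)
Lemma F2_root_branch b c M z :
  F2 M z = (z - root_branch b c M) * (z - root_branch (~~ b) (~~ c) M).
Proof.
case: z => u v; rewrite /F2 /root_branch !signrN; set D := discr M.
have E1 : ((-1) ^+ b * Num.sqrt D) ^+ 2 - ((-1) ^+ c * Num.sqrt (- D)) ^+ 2 = D.
  rewrite !exprMn !sqrr_sign !mul1r.
  have [D0|D0] := lerP 0 D.
    by rewrite sqr_sqrtr // (ler0_sqrtr (a := - D)) ?oppr_le0 // expr0n subr0.
  by rewrite (ler0_sqrtr (a := D)) 1?ltW // sqr_sqrtr ?oppr_ge0 1?ltW // expr0n sub0r opprK.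
have E2 : ((-1) ^+ b * Num.sqrt D) * ((-1) ^+ c * Num.sqrt (- D)) = 0.
  have [D0|D0] := lerP 0 D.
    by rewrite (ler0_sqrtr (a := - D)) ?oppr_le0 // !mulr0.
  by rewrite (ler0_sqrtr (a := D)) ?ltW // mulr0 mul0r.
have {}E1 : ((-1) ^+ b * Num.sqrt D) ^+ 2 - ((-1) ^+ c * Num.sqrt (- D)) ^+ 2
    = M.2 ^+ 2 - 4 * M.1 by rewrite E1.
move: E1 E2; move: ((-1) ^+ b) ((-1) ^+ c) (Num.sqrt D) (Num.sqrt (- D)).
move=> s t x y E1 E2; rewrite expr2; apply/eqP.
by rewrite eq_complex /=; apply/andP; split; apply/eqP; lra.
Qed.

Lemma root_branch_root b c : family_roots (root_branch b c).
Proof. by move=> M; rewrite (F2_root_branch b c) subrr mul0r. Qed.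

(** If d > 0, the sign condition gives x != 0, hence y = 0 and x^2 = d/4. If d <= 0, either x = 0 or
    x^2 = d/4 <= 0, so x = 0 in both cases. Exchanging x and y and negating d treats the imaginary
    part. *)
Lemma signed_half_sqrt b (x y d : R) : x ^+ 2 - y ^+ 2 = d / 4 -> x * y = 0 ->
  (0 < d -> 0 < (-1) ^+ b * x) -> x = (-1) ^+ b * (Num.sqrt d / 2).
Proof.
move=> xyd /eqP; rewrite mulf_eq0 => xy0 sx; have [d0|d0] := ltrP 0 d.
  have {}sx := sx d0.
  have y0 : y = 0.
    by case/orP: xy0 => /eqP // x0; move: sx; rewrite x0 mulr0 ltxx.
  have -> : d = (2 * ((-1) ^+ b * x)) ^+ 2
    by rewrite !exprMn sqrr_sign; rewrite y0 in xyd; lra.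
  rewrite sqrtr_sqr ger0_norm; last by rewrite mulr_ge0 // ltW.
  by rewrite mulrAC divff ?pnatr_eq0 // mul1r signrMK.
rewrite ler0_sqrtr // mul0r mulr0; apply/eqP; case/orP: xy0 => // /eqP y0.
by rewrite -sqrf_eq0; rewrite y0 in xyd; apply/eqP; nra.
Qed.

Lemma continuous_root_is_branch r :
  continuous_family_roots r -> exists b c, r = root_branch b c.
Proof.
case=> rr cr.
pose u M := complex.Re (r M) + M.2 / 2; pose v M := complex.Im (r M).
have cu : continuous u.
  move=> M; apply: cvgD; last by apply: cvgMr_tmp; exact: cvg_snd.
  by apply: (continuous_comp (cr M)); exact: continuous_Re.
have cv : continuous v.
  by move=> M; apply: (continuous_comp (cr M)); exact: continuous_Im.
(* Real and imaginary parts of (r + a_1/2)^2 = discr / 4. *)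
have uv M : u M ^+ 2 - v M ^+ 2 = discr M / 4 /\ u M * v M = 0.
  move: (rr M); rewrite /F2 /u /v /discr; case: (r M) => x y.
  rewrite expr2 => /eqP; rewrite eq_complex /= => /andP[/eqP E1 /eqP E2].
  by split; lra.
have [b ub] : exists b, forall M, 0 < 1 * discr M -> 0 < (-1) ^+ b * u M.
  apply: nonvanishing_constant_sign => // M; rewrite mul1r => D0.
  by apply/eqP => u0; have [] := uv M; rewrite u0; nra.
have [c vc] : exists c, forall M, 0 < -1 * discr M -> 0 < (-1) ^+ c * v M.
  apply: nonvanishing_constant_sign => // M; rewrite mulN1r => D0.
  by apply/eqP => v0; have [] := uv M; rewrite v0; nra.
exists b, c; apply/funext => M; have [E1 E2] := uv M.
have Eu : u M = (-1) ^+ b * (Num.sqrt (discr M) / 2).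
  by apply: signed_half_sqrt E1 E2 _ => D0; apply: ub; rewrite mul1r.
have Ev : v M = (-1) ^+ c * (Num.sqrt (- discr M) / 2).
  apply: (@signed_half_sqrt _ _ (u M)); [lra|by rewrite mulrC|].
  by move=> D0; apply: vc; rewrite mulN1r.
rewrite /root_branch -Eu -Ev /u /v; case: (r M) => x y /=.
by congr (_ +i* _); ring.
Qed.

Lemma complete_set_of_continuous_rootsP (A : set (R * R -> R[i])) :
  complete_set_of_continuous_roots A <->
  exists b c, A = [set root_branch b c; root_branch (~~ b) (~~ c)].
Proof.
split=> [[[al [be [-> _ fac]]] contA]|[b [c ->]]].
  have [b [c Eal]] := continuous_root_is_branch (contA al (or_introl erefl)).
  exists b, c; rewrite -Eal; congr [set _; _]; apply/funext => M.
  (* At [al M + 1] the first factor of both factorizations is 1, which leaves the second factors to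
     compare. *)
  have := fac M (al M + 1); rewrite (F2_root_branch b c) -Eal.
  by rewrite [al M + 1]addrC addrK !mul1r => /addrI/oppr_inj.
split; last first.
  move=> _ [|] ->; (split; first exact: root_branch_root);
    exact: continuous_root_branch.
exists (root_branch b c), (root_branch (~~ b) (~~ c)); split=> //.
  by move=> _ [|] ->; exact: root_branch_root.
exact: F2_root_branch.
Qed.

(** The case distinction in [Xi] is absorbed by the zeros of [Num.sqrt]: off the parabola exactly
    one of the two square roots vanishes, on it both do. *)
Lemma Xi_root_branch (X : set (R * R)) b c :
  (forall M, plane_plus M -> branch_sign X M = (-1) ^+ b) ->
  (forall M, plane_minus M -> branch_sign X M = (-1) ^+ c) ->
  Xi X = root_branch b c.
Proof.
move=> Xb Xc; apply/funext => M; rewrite /Xi /root_branch.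
have DE : discr M = M.2 ^+ 2 - 4 * M.1 by [].
case: ifPn => [/set_mem pM|/negP pM].
  rewrite (Xb M pM) (ler0_sqrtr (a := - discr M)) ?mul0r ?mulr0; last first.
    by rewrite DE; rewrite /plane_plus /= in pM; lra.
  by rewrite -rmorphD.
have {}pM : M.2 ^+ 2 <= 4 * M.1.
  by rewrite leNgt; apply/negP => h; apply: pM; exact: mem_set.
case: ifPn => [/set_mem zM|/negP zM].
  have -> : discr M = 0 by rewrite DE; rewrite /plane_zero /= in zM; lra.
  by rewrite oppr0 sqrtr0 mul0r !mulr0 addr0.
have mM : M.2 ^+ 2 < 4 * M.1.
  by rewrite lt_neqAle pM andbT; apply/eqP => h; apply: zM; exact: mem_set.
rewrite (Xc M mM) (ler0_sqrtr (a := discr M)) ?mul0r ?mulr0 ?addr0; last by lra.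
rewrite [RHS]complexE /=; congr (_ + _); exact: mulrC.
Qed.

Lemma branch_sign_in (X : set (R * R)) M : X M -> branch_sign X M = (-1) ^+ true.
Proof. by move=> XM; rewrite /branch_sign mem_set. Qed.

Lemma branch_sign_out (X : set (R * R)) M : ~ X M -> plane_pm M ->
  branch_sign X M = (-1) ^+ false.
Proof. by move=> XM pmM; rewrite /branch_sign !memNset. Qed.

Lemma plane_plus_pm M : plane_plus M -> plane_pm M.
Proof. by rewrite /plane_plus /plane_pm /plane_zero /= => + E; rewrite E ltxx. Qed.

Lemma plane_minus_pm M : plane_minus M -> plane_pm M.
Proof. by rewrite /plane_minus /plane_pm /plane_zero /= => + E; rewrite E ltxx. Qed.

Lemma plane_plus_minus M : plane_plus M -> ~ plane_minus M.
Proof. by rewrite /plane_plus /plane_minus /= => /ltW; rewrite leNgt => /negP. Qed.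

Lemma Xi_set0 : Xi set0 = root_branch false false.
Proof.
apply: Xi_root_branch => M MX; apply: branch_sign_out => //.
  exact: plane_plus_pm.
exact: plane_minus_pm.
Qed.

Lemma Xi_plane_pm : Xi plane_pm = root_branch true true.
Proof.
apply: Xi_root_branch => M MX; apply: branch_sign_in.
  exact: plane_plus_pm.
exact: plane_minus_pm.
Qed.

Lemma Xi_plane_plus : Xi plane_plus = root_branch true false.
Proof.
apply: Xi_root_branch => M MX; first exact: branch_sign_in.
apply: branch_sign_out; last exact: plane_minus_pm.
by move=> /plane_plus_minus; apply.
Qed.

Lemma Xi_plane_minus : Xi plane_minus = root_branch false true.
Proof.
apply: Xi_root_branch => M MX; last exact: branch_sign_in.
by apply: branch_sign_out; [exact: plane_plus_minus|exact: plane_plus_pm].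
Qed.

End QuadraticRoots.

Theorem mainTheorem2 (R : realType) :
  [set A : set (R * R -> complex R) | complete_set_of_continuous_roots A] =
  [set [set Xi set0; Xi plane_pm]; [set Xi plane_plus; Xi plane_minus]].
Proof.
rewrite Xi_set0 Xi_plane_pm Xi_plane_plus Xi_plane_minus.
apply/seteqP; split => A /=; rewrite complete_set_of_continuous_rootsP.
  (* Opposite sign choices give the same unordered pair, so the four choices yield two sets: equal
     signs on the left, unequal signs on the right. *)
  move=> [[] [[] ->]]; [left|right|right|left] => //=; exact: setUC.
by case=> ->; [exists false, false|exists true, false].
Qed.
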